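(* Let $(H,R)$ be a semiquasitriangular Hopf algebra and $M$ a finite dimensional normal $(H,R)$-module. Let $\{m_i,m_i^*\}_{i\in I}$ be dual bases of $M$ and $M^*=\operatorname{Hom}_k(M,k)$. Define on $M^*$ the left action $(h\cdot f)(m)=f(S(h)\cdot m)$ and the map $\nu_{M^*}:M^*\to M^*\otimes H$, $\nu_{M^*}(f)=\sum_{i\in I} f((m_i)_0)\,m_i^*\otimes S^{-1}((m_i)_1)$ (equivalently, $f_0(m)f_1=f(m_0)S^{-1}(m_1)$ for $m\in M$). Then $M^*$ with this action and coaction is a normal $(H,R)$-module.
   Context: All vector spaces are over a field $k$, $\otimes=\otimes_k$. For a Hopf algebra $H$ with comultiplication $\Delta$, counit $\epsilon$, antipode $S$, we use Sweedler notation $\Delta(h)=h_1\otimes h_2$, etc. $\operatorname{Z}(H)$ is the centre of $H$. For $R\in H\otimes H$ we write $R=R^{(1)}\otimes R^{(2)}$ (summation understood); $R'^{(1)}\otimes R'^{(2)}$ denotes another copy of $R$. Definition (semiquasitriangular Hopf algebra): a pair $(H,R)$ with $H$ a Hopf algebra with bijective antipode and $R\in H\otimes H$ invertible such that (1) $R^{(1)}_1\otimes R^{(1)}_2\otimes R^{(2)} = R^{(1)}\otimes R'^{(1)}\otimes R^{(2)}R'^{(2)}$; (2) $R^{(1)}\otimes R^{(2)}_1\otimes R^{(2)}_2 = R^{(1)}R'^{(1)}\otimes R'^{(2)}\otimes R^{(2)}$; (3) $R^{(1)}\otimes R^{(2)}_2R'^{(1)}\otimes R^{(2)}_1R'^{(2)}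 = R^{(1)}\otimes R'^{(1)}R^{(2)}_1\otimes R'^{(2)}R^{(2)}_2$; (4) $R^{(1)}_2R'^{(1)}\otimes R^{(1)}_1R'^{(2)}\otimes R^{(2)} = R'^{(1)}R^{(1)}_1\otimes R'^{(2)}R^{(1)}_2\otimes R^{(2)}$; (5) $\nu(h):=R^{(2)}h_2R'^{(2)}\otimes S(h_1)S(R^{(1)})h_3R'^{(1)}\in H\otimes\operatorname{Z}(H)$ for all $h\in H$; (6) $\nu(h)=R^{(1)}h_2R'^{(1)}\otimes S(R'^{(2)})S(h_1)R^{(2)}h_3$ for all $h\in H$. Definition (normal $(H,R)$-module): a vector space $M$ with a left $H$-module action $h\otimes m\mapsto h\cdot m$ and a right $H$-comodule coaction $\nu_M(m)=m_0\otimes m_1$ such that for all $h\in H$, $m\in M$: (i) $\nu_M(m)\in M\otimes\operatorname{Z}(H)$; (ii) $\nu_M(h\cdot m)=R^{(2)}h_2R'^{(2)}\cdot m_0\otimes S(h_1)S(R^{(1)})h_3R'^{(1)}m_1$. *)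

(* Defs.v *)
From HB Require Import structures.
From mathcomp Require Import all_boot all_order all_algebra.
Set Implicit Arguments. Unset Strict Implicit. Unset Printing Implicit Defensive.
Import GRing.Theory.
Local Open Scope ring_scope.

(* Elements of tensor products U (x) V (resp. U (x) V (x) W) over the field k
   are represented by finite lists of pure tensors (summation understood);
   two representatives denote the same tensor iff every bilinear
   (resp. trilinear) form takes the same value on them (i.e. iff every linear
   functional on the tensor product agrees on them). *)
Section Tensors.
Variable k : fieldType.

Definition bilinear_form (U V : lmodType k) (B : U -> V -> k) : Prop :=
  (forall (a : k) (x y : U) (v : V), B (a *: x + y) v = a * B x v + B y v) /\
  (forall (a : k) (u : U) (x y : V), B u (a *: x + y) = a * B u x + B u y).

Definition trilinear_form (U V W : lmodType k) (T : U -> V -> W -> k) : Prop :=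
  (forall (a : k) (x y : U) v w, T (a *: x + y) v w = a * T x v w + T y v w) /\
  (forall (a : k) u (x y : V) w, T u (a *: x + y) w = a * T u x w + T u y w) /\
  (forall (a : k) u v (x y : W), T u v (a *: x + y) = a * T u v x + T u v y).

Definition teq2 (U V : lmodType k) (s t : seq (U * V)) : Prop :=
  forall B : U -> V -> k, bilinear_form B ->
    \sum_(p <- s) B p.1 p.2 = \sum_(p <- t) B p.1 p.2.

Definition teq3 (U V W : lmodType k) (s t : seq (U * V * W)) : Prop :=
  forall T : U -> V -> W -> k, trilinear_form T ->
    \sum_(p <- s) T p.1.1 p.1.2 p.2 = \sum_(p <- t) T p.1.1 p.1.2 p.2.

End Tensors.

Section Hopf.
Variable k : fieldType.
Variable H : algType k.

Definition central (x : H) : Prop := forall y : H, x * y = y * x.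

Record is_hopf (Delta : H -> seq (H * H)) (eps : H -> k) (S : H -> H) : Prop := {
  Delta_lin : forall (a : k) (x y : H),
    teq2 (Delta (a *: x + y))
      ([seq (a *: p.1, p.2) | p <- Delta x] ++ Delta y);
  Delta_mul : forall x y : H,
    teq2 (Delta (x * y))
      (flatten [seq [seq (p.1 * q.1, p.2 * q.2) | q <- Delta y] | p <- Delta x]);
  Delta_1 : teq2 (Delta 1) [:: (1, 1)];
  Delta_coassoc : forall x : H,
    teq3 (flatten [seq [seq (q.1, q.2, p.2) | q <- Delta p.1] | p <- Delta x])
         (flatten [seq [seq (p.1, q.1, q.2) | q <- Delta p.2] | p <- Delta x]);
  eps_lin : forall (a : k) (x y : H), eps (a *: x + y) = a * eps x + eps y;
  eps_mul : forall x y : H, eps (x * y) = eps x * eps y;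
  eps_1 : eps 1 = 1;
  counit_l : forall x : H, \sum_(p <- Delta x) eps p.1 *: p.2 = x;
  counit_r : forall x : H, \sum_(p <- Delta x) eps p.2 *: p.1 = x;
  S_lin : forall (a : k) (x y : H), S (a *: x + y) = a *: S x + S y;
  antipode_l : forall x : H, \sum_(p <- Delta x) S p.1 * p.2 = eps x *: 1;
  antipode_r : forall x : H, \sum_(p <- Delta x) p.1 * S p.2 = eps x *: 1
}.

Variables (Delta : H -> seq (H * H)) (S : H -> H).

Definition Delta2 (h : H) : seq (H * H * H) :=
  flatten [seq [seq (p.1, q.1, q.2) | q <- Delta p.2] | p <- Delta h].

Definition nuR (R : seq (H * H)) (h : H) : seq (H * H) :=
  flatten [seq flatten [seq [seq (r.2 * t.1.2 * r'.2, S t.1.1 * S r.1 * t.2 * r'.1)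
                            | r' <- R] | t <- Delta2 h] | r <- R].

Definition nuR' (R : seq (H * H)) (h : H) : seq (H * H) :=
  flatten [seq flatten [seq [seq (r.1 * t.1.2 * r'.1, S r'.2 * S t.1.1 * r.2 * t.2)
                            | r' <- R] | t <- Delta2 h] | r <- R].

Definition in_tens_center (U : lmodType k) (s : seq (U * H)) : Prop :=
  exists t : seq (U * H), teq2 s t /\ (forall p, p \in t -> central p.2).

Definition tens_mul (s t : seq (H * H)) : seq (H * H) :=
  flatten [seq [seq (p.1 * q.1, p.2 * q.2) | q <- t] | p <- s].

Definition semiquasitriangular (R : seq (H * H)) : Prop :=
  (exists Rinv : seq (H * H),
      teq2 (tens_mul R Rinv) [:: (1, 1)] /\ teq2 (tens_mul Rinv R) [:: (1, 1)]) /\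
  teq3 (flatten [seq [seq (q.1, q.2, r.2) | q <- Delta r.1] | r <- R])
       (flatten [seq [seq (r.1, r'.1, r.2 * r'.2) | r' <- R] | r <- R]) /\
  teq3 (flatten [seq [seq (r.1, q.1, q.2) | q <- Delta r.2] | r <- R])
       (flatten [seq [seq (r.1 * r'.1, r'.2, r.2) | r' <- R] | r <- R]) /\
  teq3 (flatten [seq flatten [seq [seq (r.1, q.2 * r'.1, q.1 * r'.2) | r' <- R]
                               | q <- Delta r.2] | r <- R])
       (flatten [seq flatten [seq [seq (r.1, r'.1 * q.1, r'.2 * q.2) | r' <- R]
                               | q <- Delta r.2] | r <- R]) /\
  teq3 (flatten [seq flatten [seq [seq (q.2 * r'.1, q.1 * r'.2, r.2) | r' <- R]
                               | q <- Delta r.1] | r <- R])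
       (flatten [seq flatten [seq [seq (r'.1 * q.1, r'.2 * q.2, r.2) | r' <- R]
                               | q <- Delta r.1] | r <- R]) /\
  (forall h : H, in_tens_center (nuR R h)) /\
  (forall h : H, teq2 (nuR R h) (nuR' R h)).

Definition is_left_module (M : lmodType k) (act : H -> M -> M) : Prop :=
  (forall (a : k) (x y : H) (m : M), act (a *: x + y) m = a *: act x m + act y m) /\
  (forall (a : k) (x : H) (m n : M), act x (a *: m + n) = a *: act x m + act x n) /\
  (forall m : M, act 1 m = m) /\
  (forall (x y : H) (m : M), act (x * y) m = act x (act y m)).

Definition is_right_comodule (eps : H -> k) (M : lmodType k)
    (nuM : M -> seq (M * H)) : Prop :=
  (forall (a : k) (m n : M),
     teq2 (nuM (a *: m + n)) ([seq (a *: p.1, p.2) | p <- nuM m] ++ nuM n)) /\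
  (forall m : M,
     teq3 (flatten [seq [seq (p.1, q.1, q.2) | q <- Delta p.2] | p <- nuM m])
          (flatten [seq [seq (q.1, q.2, p.2) | q <- nuM p.1] | p <- nuM m])) /\
  (forall m : M, \sum_(p <- nuM m) eps p.2 *: p.1 = m).

Definition normal_module (eps : H -> k) (R : seq (H * H)) (M : lmodType k)
    (act : H -> M -> M) (nuM : M -> seq (M * H)) : Prop :=
  is_left_module act /\ is_right_comodule eps nuM /\
  (forall m : M, in_tens_center (nuM m)) /\
  (forall (h : H) (m : M),
     teq2 (nuM (act h m))
       (flatten [seq flatten [seq flatten [seq
          [seq (act (r.2 * t.1.2 * r'.2) p.1, S t.1.1 * S r.1 * t.2 * r'.1 * p.2)
          | p <- nuM m] | r' <- R] | t <- Delta2 h] | r <- R])).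

End Hopf.

Section Dual.
Variables (k : fieldType) (H : algType k) (M : vectType k).

Definition dual_act (S : H -> H) (act : H -> M -> M) (h : H)
    (f : 'Hom(M, k^o)) : 'Hom(M, k^o) :=
  linfun (fun m : M => f (act (S h) m)).

Definition dual_coact (Sinv : H -> H) (nuM : M -> seq (M * H)) (n : nat)
    (X : n.-tuple M) (f : 'Hom(M, k^o)) : seq ('Hom(M, k^o) * H) :=
  flatten [seq [seq ((f p.1 : k) *: (linfun (coord X i : M -> k^o)), Sinv p.2)
               | p <- nuM (X`_i)] | i <- enum 'I_n].
End Dual.

(* Main.v *)
(* Write [nu h = h_0 (x) h_1].  By (2) and the centrality in (5), the map
   [h |-> S h_0 (x) h_1] is a left convolution inverse of [nu]; by (1) and
   centrality [nu] is multiplicative, so [nu \o S] is a right one.  Hence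
   [nu (S h) = S h_0 (x) h_1].  On a normal module the coaction, seen as an
   invertible element of [End M (x) Z(H)] with inverse [m |-> m_0 (x) S m_1],
   conjugates the action of [h] into that of [nu h]; uniqueness of inverses also
   gives [m_0 (x) S m_1 = m_0 (x) S^-1 m_1].  Evaluating the compatibility
   condition of the dual at [m] reduces it to these facts at [S h]. *)
Require Import Defs.
From mathcomp Require Import all_boot all_order all_algebra.
From HB Require Import structures.
From mathcomp Require classical_sets.
Set Implicit Arguments.
Unset Strict Implicit.
Unset Printing Implicit Defensive.
Import GRing.Theory.
Local Open Scope ring_scope.

(** * Multilinear maps and formal tensors *)

Section Multilinear.
Variable k : fieldType.

(** A predicate on bare functions: the lambda terms coming from Sweedler sums then need no
    registered linear structure. *)
Definition lin (U V : lmodType k) (f : U -> V) : Prop :=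
  forall a x y, f (a *: x + y) = a *: f x + f y.

Definition bilin (U V W : lmodType k) (B : U -> V -> W) : Prop :=
  (forall v, lin (B^~ v)) /\ (forall u, lin (B u)).

Definition trilin (U V W X : lmodType k) (T : U -> V -> W -> X) : Prop :=
  (forall w, bilin (fun u v => T u v w)) /\ (forall u v, lin (T u v)).

Section LinTheory.
Variables U V W : lmodType k.

Lemma linB (f : U -> V) x y : lin f -> f (x - y) = f x - f y.
Proof. by move=> fL; rewrite addrC -scaleN1r fL scaleN1r addrC. Qed.

Lemma lin0 (f : U -> V) : lin f -> f 0 = 0.
Proof. by move=> fL; rewrite -(subrr 0) linB // subrr. Qed.

Lemma linD (f : U -> V) x y : lin f -> f (x + y) = f x + f y.
Proof. by move=> fL; rewrite -[x]scale1r fL !scale1r. Qed.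

Lemma linZ (f : U -> V) a x : lin f -> f (a *: x) = a *: f x.
Proof. by move=> fL; rewrite -[a *: x]addr0 fL lin0 // addr0. Qed.

Lemma lin_sum (f : U -> V) (I : Type) (r : seq I) (E : I -> U) :
  lin f -> f (\sum_(i <- r) E i) = \sum_(i <- r) f (E i).
Proof.
move=> fL; elim: r => [|i r IH]; first by rewrite !big_nil lin0.
by rewrite !big_cons linD // IH.
Qed.

Lemma lin_id : lin (fun x : U => x).
Proof. by []. Qed.

Lemma lin_comp (g : V -> W) (f : U -> V) : lin g -> lin f -> lin (fun x => g (f x)).
Proof. by move=> gL fL a x y; rewrite fL gL. Qed.

Lemma lin_scaler (f : U -> V) c : lin f -> lin (fun x => c *: f x).
Proof. by move=> fL a x y; rewrite fL scalerDr !scalerA mulrC. Qed.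

Lemma lin_scalel (f : U -> k^o) (v : V) : lin f -> lin (fun x => (f x : k) *: v).
Proof. by move=> fL a x y; rewrite fL scalerDl scalerA. Qed.

Lemma lin_bigsum (I : Type) (r : seq I) (E : U -> I -> V) :
  (forall i, lin (E^~ i)) -> lin (fun x => \sum_(i <- r) E x i).
Proof.
move=> EL a x y; rewrite scaler_sumr -big_split /=.
by apply: eq_bigr => i _; rewrite (EL i).
Qed.

End LinTheory.

Lemma lin_lfun (U : lmodType k) (V W : vectType k) (f : 'Hom(V, W)) (g : U -> V) :
  lin g -> lin (fun x => f (g x)).
Proof. by move=> gL a x y; rewrite gL linearP. Qed.

Lemma lin_lfunl (U : lmodType k) (V W : vectType k) (v : V) (g : U -> 'Hom(V, W)) :
  lin g -> lin (fun x => g x v).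
Proof. by move=> gL a x y; rewrite gL add_lfunE scale_lfunE. Qed.

Lemma lin_mull (U : lmodType k) (A : algType k) (f : U -> A) c :
  lin f -> lin (fun x => f x * c).
Proof. by move=> fL a x y; rewrite fL mulrDl scalerAl. Qed.

Lemma lin_mulr (U : lmodType k) (A : algType k) (f : U -> A) c :
  lin f -> lin (fun x => c * f x).
Proof. by move=> fL a x y; rewrite fL mulrDr scalerAr. Qed.

(* For a maximal subspace [N] avoiding [w], every [x] is [c w] modulo [N] for
   exactly one scalar [c]; this coordinate is a functional with value [1] at [w]. *)
Lemma functional_separation (W : lmodType k) (w : W) :
  (forall f : W -> k^o, lin f -> f w = 0) -> w = 0.
Proof.
move=> fw0; apply/eqP/negP => /negP w_neq0.
pose P (N : classical_sets.set W) :=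
  (forall a x y, N x -> N y -> N (a *: x + y)) /\ ~ N w.
have [|N [[NL Nw] Nmax]] := @classical_sets.Zorn_bigcup W P.
  move=> F FP Ftot; split=> [a x y [N1 FN1 N1x] [N2 FN2 N2y]|[N FN]];
    last exact: (FP N FN).2.
  have [le12|le21] := Ftot _ _ FN1 FN2.
    by exists N2 => //; apply: (FP _ FN2).1 => //; apply: le12.
  by exists N1 => //; apply: (FP _ FN1).1 => //; apply: le21.
(* [P] admits the empty set, so the union of the empty chain satisfies it. A maximal [N] without [0]
   would be empty, and the zero subspace would be strictly larger. *)
have N0 : N 0.
  have [//|N0] := boolp.EM (N 0).
  have [] : False; apply: (Nmax (fun x => x = 0)).
    split=> [x Nx|sub]; last by apply: N0; apply: sub.
    by have [] := N0; rewrite -(addNr x) -scaleN1r; apply: NL.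
  by split=> [a x y -> ->|w0]; [rewrite scaler0 addr0|rewrite w0 eqxx in w_neq0].
have NZ a x : N x -> N (a *: x) by move=> Nx; rewrite -[_ *: _]addr0; apply: NL.
have NB x y : N x -> N y -> N (x - y).
  by move=> Nx Ny; rewrite addrC -scaleN1r; apply: NL.
have coordN x : exists c : k, N (x - c *: w).
  have [Nx|Nx] := boolp.EM (N x); first by exists 0; rewrite scale0r subr0.
  have [//|noc] := boolp.EM (exists c : k, N (x - c *: w)).
  (* If [x] is not in [N], the larger subspace [N + k x] must contain [w]. The coefficient [b] of
     [x] in [w] is nonzero because [w] is not in [N], so [b^-1] is the coordinate sought. *)
  have [] : False; apply: (Nmax (fun z => exists b n, N n /\ z = b *: x + n)).
    split=> [z Nz|sub]; first by exists 0, z; rewrite scale0r add0r.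
    by apply: Nx; apply: sub; exists 1, 0; rewrite scale1r addr0.
  split=> [a y z [b [n [Nn ->]]] [b' [n' [Nn' ->]]]|[b [n [Nn wE]]]].
    exists (a * b + b'), (a *: n + n'); split; first exact: NL.
    by rewrite scalerDr scalerA scalerDl addrACA.
  apply: noc; exists b^-1.
  have b_neq0 : b != 0 by apply: contra_notN Nw => /eqP b0; rewrite wE b0 scale0r add0r.
  suff -> : x - b^-1 *: w = (- b^-1) *: n by apply: NZ.
  by rewrite wE scalerDr scalerA mulVf // scale1r opprD addrA subrr add0r scaleNr.
have [f fP] := boolp.choice coordN.
have fE x c : N (x - c *: w) -> f x = c.
  move=> Nxc; apply/eqP; rewrite -subr_eq0; apply: contra_notT Nw => fc.
  have := NZ (f x - c)^-1 _ (NB _ _ Nxc (fP x)).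
  by rewrite opprB [X in _ *: X]addrC addrA subrK -scalerBl scalerA mulVf // scale1r.
have fL : lin (f : W -> k^o).
  move=> a x y; apply: fE.
  by rewrite scalerDl opprD -scalerA addrACA -scalerBr; apply: NL.
move/eqP: (fw0 f fL); rewrite (fE w 1) ?scale1r ?subrr //.
by rewrite oner_eq0.
Qed.

Variables U V W X : lmodType k.

(* The value at [s] of the linear map on [U (x) V] induced by a bilinear [B]; with
   [s := Delta h] this is the Sweedler expression [B h_1 h_2]. *)
Definition tsum (s : seq (U * V)) (B : U -> V -> W) : W := \sum_(p <- s) B p.1 p.2.

(** [teq2] only tests scalar forms; vector-valued bilinear maps follow by composing with
    functionals, which separate the points of [W]. *)
Lemma teq2_tsum (s t : seq (U * V)) (B : U -> V -> W) :
  teq2 s t -> bilin B -> tsum s B = tsum t B.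
Proof.
move=> st [Bl Br]; apply/eqP; rewrite -subr_eq0; apply/eqP.
apply: functional_separation => f fL; rewrite (linB _ _ fL) !(lin_sum _ _ fL).
have -> := st (fun u v => f (B u v)); first exact: subrr.
by split=> a u v w; [rewrite (Bl w)|rewrite (Br u)]; apply: fL.
Qed.

Lemma teq3_sum (s t : seq (U * V * X)) (T : U -> V -> X -> W) :
  teq3 s t -> trilin T ->
  \sum_(p <- s) T p.1.1 p.1.2 p.2 = \sum_(p <- t) T p.1.1 p.1.2 p.2.
Proof.
move=> st [TB Tr]; apply/eqP; rewrite -subr_eq0; apply/eqP.
apply: functional_separation => f fL; rewrite (linB _ _ fL) !(lin_sum _ _ fL).
have -> := st (fun u v x => f (T u v x)); first exact: subrr.
split; [|split].
- by move=> a x y v w; rewrite ((TB w).1 v); apply: fL.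
- by move=> a u x y w; rewrite ((TB w).2 u); apply: fL.
- by move=> a u v x y; rewrite (Tr u v); apply: fL.
Qed.

End Multilinear.

Notation "\tsum_ ( a , b <- s ) E" := (tsum s (fun a b => E))
  (at level 41, E at level 41, a name, b name, s at level 50,
   format "'[' \tsum_ ( a ,  b  <-  s ) '/  '  E ']'") : ring_scope.

Section TensorSums.
Variable k : fieldType.
Implicit Types U V W X : lmodType k.

(* [linT D] says that [D] represents a linear map into the tensor product. *)
Definition linT U V X (D : X -> seq (U * V)) : Prop :=
  forall (W : lmodType k) (B : U -> V -> W), bilin B -> lin (fun x => tsum (D x) B).

Lemma eq_tsum U V W (s : seq (U * V)) (B B' : U -> V -> W) :
  (forall u v, B u v = B' u v) -> tsum s B = tsum s B'.
Proof. by move=> BB; apply: eq_bigr => p _; apply: BB. Qed.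

Lemma exchange_tsum U V U' V' W (s : seq (U * V)) (t : seq (U' * V'))
    (F : U -> V -> U' -> V' -> W) :
  \tsum_(a, b <- s) \tsum_(c, d <- t) F a b c d =
  \tsum_(c, d <- t) \tsum_(a, b <- s) F a b c d.
Proof. exact: exchange_big. Qed.

Lemma tsum_cat U V W (s t : seq (U * V)) (B : U -> V -> W) :
  tsum (s ++ t) B = tsum s B + tsum t B.
Proof. exact: big_cat. Qed.

Lemma big_flatten_map (I J : Type) (W : nmodType) (s : seq I) (f : I -> seq J) (F : J -> W) :
  \sum_(p <- flatten [seq f x | x <- s]) F p = \sum_(x <- s) \sum_(p <- f x) F p.
Proof. by rewrite big_flatten big_map. Qed.

Lemma lin_tsum_pull U V W X (s : seq (U * V)) (f : W -> X) (B : U -> V -> W) :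
  lin f -> f (tsum s B) = \tsum_(a, b <- s) f (B a b).
Proof. by move=> fL; apply: lin_sum. Qed.

Lemma lin_tsum U V W X (s : seq (U * V)) (B : X -> U -> V -> W) :
  (forall u v, lin (fun x => B x u v)) -> lin (fun x => tsum s (B x)).
Proof. by move=> BL; apply: lin_bigsum => p. Qed.

Lemma tsum_scale U V W (s : seq (U * V)) (B : U -> V -> W) a :
  bilin B -> tsum [seq (a *: p.1, p.2) | p <- s] B = a *: tsum s B.
Proof.
move=> Bb; rewrite /tsum big_map scaler_sumr; apply: eq_bigr => p _.
by rewrite (linZ _ _ (Bb.1 _)).
Qed.

Lemma teq2_bilin U V (s t : seq (U * V)) :
  (forall B : U -> V -> k^o, bilin B -> tsum s B = tsum t B) -> teq2 s t.
Proof. by move=> st B [Bl Br]; apply: (st B); split=> [v a x y|u a x y];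
  [apply: Bl|apply: Br]. Qed.

Lemma teq3_trilin U V X (s t : seq (U * V * X)) :
  (forall T : U -> V -> X -> k^o, trilin T ->
    \sum_(p <- s) T p.1.1 p.1.2 p.2 = \sum_(p <- t) T p.1.1 p.1.2 p.2) ->
  teq3 s t.
Proof.
move=> st T [Tl [Tm Tr]]; apply: (st T).
by split=> [w|u v]; [split=> [v|u]|]; move=> a x y; [apply: Tl|apply: Tm|apply: Tr].
Qed.

Lemma linT_cat U V X (D : X -> seq (U * V)) :
  (forall a x y, teq2 (D (a *: x + y)) ([seq (a *: p.1, p.2) | p <- D x] ++ D y)) ->
  linT D.
Proof.
move=> DL W B Bb a x y; rewrite (teq2_tsum (DL a x y) Bb) tsum_cat; congr (_ + _).
exact: tsum_scale.
Qed.

End TensorSums.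

(** Each rule peels off the outermost operation around the bound variable. The rules for [linT],
    [trilin], [bilin] and [lin] read hypotheses, so facts about structure maps only have to be in
    the context. *)
Ltac linearity_rule :=
  match goal with
  | |- bilin _ => split
  | |- trilin _ => split
  | |- lin (fun x => x) => exact: lin_id
  | |- lin (fun x => tsum ?s (@?B x)) => refine (@lin_tsum _ _ _ _ _ _ B _)
  | |- lin (fun x => ?c * @?F x) => refine (@lin_mulr _ _ _ F _ _)
  | |- lin (fun x => @?F x * ?c) => refine (@lin_mull _ _ _ F _ _)
  | |- lin (fun x => ?c *: @?F x) => refine (@lin_scaler _ _ _ F _ _)
  | |- lin (fun x => @?F x *: ?c) => refine (@lin_scalel _ _ _ F _ _)
  | H : linT ?D |- lin (fun x => tsum (?D (@?F x)) ?B) =>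
      refine (@lin_comp _ _ _ _ _ F (H _ B _) _)
  | H : trilin ?T |- lin (fun x => ?T (@?F x) ?b ?c) =>
      refine (@lin_comp _ _ _ _ _ F ((proj1 H c).1 b) _)
  | H : trilin ?T |- lin (fun x => ?T ?a (@?F x) ?c) =>
      refine (@lin_comp _ _ _ _ _ F ((proj1 H c).2 a) _)
  | H : trilin ?T |- lin (fun x => ?T ?a ?b (@?F x)) =>
      refine (@lin_comp _ _ _ _ _ F (proj2 H a b) _)
  | H : bilin ?B |- lin (fun x => ?B (@?F x) ?c) =>
      refine (@lin_comp _ _ _ _ _ F (proj1 H c) _)
  | H : bilin ?B |- lin (fun x => ?B ?c (@?F x)) =>
      refine (@lin_comp _ _ _ _ _ F (proj2 H c) _)
  | H : trilin ?T |- lin (?T ?a ?b) => exact: (proj2 H a b)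
  | H : bilin ?B |- lin (?B ?c) => exact: (proj2 H c)
  | H : lin ?f |- lin (fun x => ?f (@?F x)) =>
      refine (@lin_comp _ _ _ _ _ F H _)
  | H : lin ?f |- lin ?f => exact: H
  | |- lin (fun x => fun_of_lfun _ (@?F x)) => refine (@lin_lfun _ _ _ _ _ F _)
  | |- lin (fun x => fun_of_lfun (@?F x) _) => refine (@lin_lfunl _ _ _ _ _ F _)
  end.

(* Sums over [Delta] or [R] commute; [reorder] permutes the nested sums of the
   left-hand side into the order of the right-hand side. *)
Ltac pull t :=
  lazymatch goal with
  | |- tsum t _ = _ => reflexivity
  | |- tsum _ _ = _ =>
      etransitivity; [apply: eq_tsum => ? ?; pull t | exact: exchange_tsum]
  end.

Ltac reorder :=
  repeat lazymatch goal with
  | |- tsum _ _ = tsum ?t _ => etransitivity; [pull t | apply: eq_tsum => ? ?]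
  end.

Ltac linearity := repeat (intros; cbv beta; linearity_rule).

(** * Hopf algebras *)

Section Hopf.
Variables (k : fieldType) (H : algType k).
Variables (Delta : H -> seq (H * H)) (eps : H -> k) (S Sinv : H -> H).
Hypothesis hopf : is_hopf Delta eps S.

Implicit Types (W : lmodType k) (h x y : H).

Lemma linT_Delta : linT Delta.
Proof. exact: linT_cat (Delta_lin hopf). Qed.

Lemma lin_eps : lin (eps : H -> k^o).
Proof. exact: (eps_lin hopf). Qed.

Lemma lin_S : lin S.
Proof. exact: (S_lin hopf). Qed.

(** Local copies of the lemmas, placed in the context where [linearity] looks for them. *)
Let DL := linT_Delta.
Let eL := lin_eps.
Let SL := lin_S.

(** The entries of [s] need not be central themselves; only an equivalent representative has central
    second legs. Passing to it and back makes centrality usable inside any bilinear expression. *)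
Lemma in_tens_center_eq (U W : lmodType k) (s : seq (U * H)) (B B' : U -> H -> W) :
  in_tens_center s -> bilin B -> bilin B' ->
  (forall u z, central z -> B u z = B' u z) -> tsum s B = tsum s B'.
Proof.
move=> [t [st tC]] Bb B'b BB'; rewrite !(teq2_tsum st) //.
by rewrite /tsum !big_seq; apply: eq_bigr => p /tC /BB'.
Qed.

Lemma comul_mul W (B : H -> H -> W) x y : bilin B ->
  tsum (Delta (x * y)) B =
  \tsum_(a, b <- Delta x) \tsum_(c, d <- Delta y) B (a * c) (b * d).
Proof.
move=> Bb; rewrite (teq2_tsum (Delta_mul hopf x y) Bb) /tsum big_flatten_map.
by apply: eq_bigr => p _; rewrite big_map.
Qed.

Lemma comul_1 W (B : H -> H -> W) : bilin B -> tsum (Delta 1) B = B 1 1.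
Proof. by move=> Bb; rewrite (teq2_tsum (Delta_1 hopf) Bb) /tsum big_seq1. Qed.

Lemma comulA W (T : H -> H -> H -> W) h : trilin T ->
  \tsum_(q, c <- Delta h) \tsum_(a, b <- Delta q) T a b c =
  \tsum_(a, q <- Delta h) \tsum_(b, c <- Delta q) T a b c.
Proof.
move=> Tt; have := teq3_sum (Delta_coassoc hopf h) Tt.
rewrite !big_flatten_map /tsum; under eq_bigr do rewrite big_map /=.
by move=> ->; apply: eq_bigr => p _; rewrite big_map.
Qed.

(** [G] stands for the summand as it occurs in a goal and [F] for what the contraction leaves;
    bringing [G] to the contracted shape becomes a side condition. The following contraction lemmas
    have the same form. *)
Lemma comul_counitl W (F : H -> W) (G : H -> H -> W) h :
  (forall a b, G a b = eps a *: F b) -> lin F -> tsum (Delta h) G = F h.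
Proof.
move=> GF FL; rewrite -[in RHS](counit_l hopf h) (lin_sum _ _ FL).
by apply: eq_bigr => p _; rewrite GF (linZ _ _ FL).
Qed.

Lemma comul_counitr W (F : H -> W) (G : H -> H -> W) h :
  (forall a b, G a b = eps b *: F a) -> lin F -> tsum (Delta h) G = F h.
Proof.
move=> GF FL; rewrite -[in RHS](counit_r hopf h) (lin_sum _ _ FL).
by apply: eq_bigr => p _; rewrite GF (linZ _ _ FL).
Qed.

Lemma comul_antipodel W (F : H -> W) (G : H -> H -> W) h :
  (forall a b, G a b = F (S a * b)) -> lin F -> tsum (Delta h) G = eps h *: F 1.
Proof.
move=> GF FL; rewrite -(linZ _ _ FL) -(antipode_l hopf) (lin_sum _ _ FL).
by apply: eq_bigr => p _; rewrite GF.
Qed.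

Lemma comul_antipoder W (F : H -> W) (G : H -> H -> W) h :
  (forall a b, G a b = F (a * S b)) -> lin F -> tsum (Delta h) G = eps h *: F 1.
Proof.
move=> GF FL; rewrite -(linZ _ _ FL) -(antipode_r hopf) (lin_sum _ _ FL).
by apply: eq_bigr => p _; rewrite GF.
Qed.

Lemma antipode1 : S 1 = 1.
Proof.
have E : \tsum_(a, b <- Delta 1) S a * b = S 1 * 1 by rewrite comul_1 //; linearity.
rewrite -[LHS]mulr1 -E (comul_antipodel (F := fun z => z)) //.
by rewrite (eps_1 hopf) scale1r.
Qed.

(** Both sides are convolution inverses of the multiplication on [H (x) H]. [T] is the summand of
    the triple convolution product, with [x] split into [a, c, d] and [y] into [b, e, g].
    Contracting [e * S g] and [c * S d] leaves [S (x * y)]; contracting [S (a * b) * (c * e)] leaves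
    [S y * S x]. *)
Lemma antipodeM x y : S (x * y) = S y * S x.
Proof.
pose T a b c e g d := S (a * b) * c * e * S g * S d.
transitivity (\tsum_(a, p <- Delta x) \tsum_(b, q <- Delta y)
  \tsum_(c, d <- Delta p) \tsum_(e, g <- Delta q) T a b c e g d).
  symmetry; apply: (comul_counitr (F := fun a => S (a * y))) => [a p|]; last by linearity.
  apply: (comul_counitr (F := fun b => eps p *: S (a * b))) => [b q|]; last by linearity.
  transitivity (\tsum_(c, d <- Delta p) eps q *: (S (a * b) * (c * S d))).
    apply: eq_tsum => c d; rewrite (comul_antipoder (F := fun z =>
      S (a * b) * c * z * S d)).
    - by rewrite mulr1 mulrA.
    - by rewrite /T; move=> *; rewrite !mulrA.
    - by linearity.
  rewrite (comul_antipoder (F := fun z => eps q *: (S (a * b) * z))) //; last by linearity.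
  by rewrite mulr1 !scalerA mulrC.
transitivity (\tsum_(a, p <- Delta x) \tsum_(c, d <- Delta p)
  \tsum_(b, q <- Delta y) \tsum_(e, g <- Delta q) T a b c e g d).
  by apply: eq_tsum => a p; rewrite exchange_tsum.
rewrite -(comulA (T := fun a c d => \tsum_(b, q <- Delta y)
  \tsum_(e, g <- Delta q) T a b c e g d)); last by rewrite /T; linearity.
apply: (comul_counitl (F := fun d => S y * S d)) => [p d|]; last by linearity.
transitivity (\tsum_(a, c <- Delta p) \tsum_(q, g <- Delta y)
  \tsum_(b, e <- Delta q) T a b c e g d).
  by apply: eq_tsum => a c; rewrite (comulA (T := fun b e g => T a b c e g d)) // /T;
    linearity.
rewrite exchange_tsum.
apply: (comul_counitl (F := fun g => eps p *: (S g * S d))) => [q g|]; last by linearity.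
transitivity (\tsum_(u, v <- Delta (p * q)) S u * v * S g * S d).
  rewrite comul_mul; last by linearity.
  by apply: eq_tsum => a c; apply: eq_tsum => b e; rewrite /T !mulrA.
rewrite (comul_antipodel (F := fun z => z * S g * S d)) //; last by linearity.
by rewrite (eps_mul hopf) mul1r scalerA mulrC.
Qed.

Lemma counit_antipode h : eps (S h) = eps h.
Proof.
have E : eps (\tsum_(a, b <- Delta h) S a * b) = eps h.
  rewrite (comul_antipodel (F := fun z => z)) //.
  by rewrite (linZ _ _ eL) (eps_1 hopf) /GRing.scale /= mulr1.
rewrite -[RHS]E (lin_tsum_pull _ _ eL).
rewrite (comul_counitr (F := fun a => eps (S a) : k^o)) //; last by linearity.
by move=> a b; rewrite (eps_mul hopf) mulrC.
Qed.

(* Both sides are convolution inverses of [Delta]. *)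
Lemma antipode_comul W (B : H -> H -> W) h : bilin B ->
  tsum (Delta (S h)) B = \tsum_(a, b <- Delta h) B (S b) (S a).
Proof.
move=> Bb.
(* Summand of the convolution product of [Delta \o S], [Delta] and [h |-> S h_2 (x) S h_1]; the last
   two factors contract first, then the first two. *)
pose T a b c := \tsum_(s, t <- Delta (S a)) \tsum_(u, v <- Delta b) \tsum_(p, q <- Delta c)
  B (s * u * S q) (t * v * S p).
have Tt : trilin T by rewrite /T; linearity.
transitivity (\tsum_(a, q <- Delta h) \tsum_(b, c <- Delta q) T a b c).
  symmetry; apply: (comul_counitr (F := fun a => tsum (Delta (S a)) B)) => [a q|];
    last by linearity.
  rewrite /T.
  rewrite exchange_tsum (lin_tsum_pull _ _ (lin_scaler _ (@lin_id _ _))).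
  apply: eq_tsum => s t.
  transitivity (\tsum_(u, z <- Delta q) \tsum_(v, c <- Delta z) \tsum_(p, g <- Delta c)
    B (s * u * S g) (t * v * S p)).
    rewrite -(comulA (T := fun u v c => \tsum_(p, g <- Delta c)
      B (s * u * S g) (t * v * S p))) //.
    by linearity.
  transitivity (\tsum_(u, z <- Delta q) B (s * (u * S z)) t).
    apply: eq_tsum => u z.
    rewrite -(comulA (T := fun v p g => B (s * u * S g) (t * v * S p))); last by linearity.
    apply: (comul_counitl (F := fun g => B (s * (u * S g)) t)) => [w g|]; last by linearity.
    rewrite (comul_antipoder (F := fun z => B (s * u * S g) (t * z))) ?mulr1 ?mulrA //; last by linearity.
    by move=> *; rewrite !mulrA.
  rewrite (comul_antipoder (F := fun z => B (s * z) t)) ?mulr1 //; by linearity.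
rewrite -(comulA _ Tt).
apply: (comul_counitl (F := fun c => \tsum_(p, q <- Delta c) B (S q) (S p))) => [q c|];
  last by linearity.
transitivity (\tsum_(a, b <- Delta q) \tsum_(u, v <- Delta (S a * b))
  \tsum_(p, g <- Delta c)
   B (u * S g) (v * S p)).
  by apply: eq_tsum => a b; rewrite comul_mul //; linearity.
rewrite (comul_antipodel (F := fun z => \tsum_(u, v <- Delta z) \tsum_(p, g <- Delta c)
   B (u * S g) (v * S p))) //; last by linearity.
rewrite comul_1; last by linearity.
by congr (_ *: _); apply: eq_tsum => p g; rewrite !mul1r.
Qed.

(** * Bijective antipode *)

Hypotheses (SK : cancel S Sinv) (SinvK : cancel Sinv S).

Lemma lin_Sinv : lin Sinv.
Proof. by move=> a x y; rewrite -[RHS]SK SL !SinvK. Qed.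

Let S'L := lin_Sinv.

Lemma antipode_invM x y : Sinv (x * y) = Sinv y * Sinv x.
Proof. by rewrite -[RHS]SK antipodeM !SinvK. Qed.

Lemma counit_antipode_inv h : eps (Sinv h) = eps h.
Proof. by rewrite -counit_antipode SinvK. Qed.

Lemma central_antipode_inv x : central x -> central (Sinv x).
Proof.
by move=> xC y; rewrite -[y]SK -!antipode_invM xC.
Qed.

Lemma antipode_inv_comul W (B : H -> H -> W) h : bilin B ->
  tsum (Delta (Sinv h)) B = \tsum_(a, b <- Delta h) B (Sinv b) (Sinv a).
Proof.
move=> Bb; rewrite -[in RHS](SinvK h) antipode_comul; last by linearity.
by apply: eq_tsum => a b; rewrite !SK.
Qed.

(** [S] is injective and reverses products, so it turns [h_2 * Sinv h_1] into [h_1 * S h_2], to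
    which the antipode axiom applies. *)
Lemma comul_antipode_inv W (F : H -> W) (G : H -> H -> W) h :
  (forall a b, G a b = F (b * Sinv a)) -> lin F -> tsum (Delta h) G = eps h *: F 1.
Proof.
move=> GF FL; rewrite -(linZ _ _ FL).
have -> : eps h *: 1 = \tsum_(a, b <- Delta h) b * Sinv a.
  apply: (can_inj SK); rewrite (lin_tsum_pull _ _ SL) (linZ _ _ SL) antipode1.
  rewrite (comul_antipoder (F := fun z => z)) // => a b.
  by rewrite antipodeM SinvK.
by rewrite (lin_tsum_pull _ _ FL); apply: eq_tsum.
Qed.

(** * Semiquasitriangular structures *)

Section Semiquasitriangular.
Variable R : seq (H * H).
Hypothesis sqtR : semiquasitriangular Delta S R.

Lemma sqt_coproductl W (T : H -> H -> H -> W) : trilin T ->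
  \tsum_(a, b <- R) \tsum_(u, v <- Delta a) T u v b =
  \tsum_(a, b <- R) \tsum_(a', b' <- R) T a a' (b * b').
Proof.
case: sqtR => _ [E _] Tt; have := teq3_sum E Tt; rewrite !big_flatten_map /tsum.
under eq_bigr do rewrite big_map; move=> ->.
by apply: eq_bigr => p _; rewrite big_map.
Qed.

Lemma sqt_coproductr W (T : H -> H -> H -> W) : trilin T ->
  \tsum_(a, b <- R) \tsum_(u, v <- Delta b) T a u v =
  \tsum_(a, b <- R) \tsum_(a', b' <- R) T (a * a') b' b.
Proof.
case: sqtR => _ [_ [E _]] Tt; have := teq3_sum E Tt; rewrite !big_flatten_map /tsum.
under eq_bigr do rewrite big_map; move=> ->.
by apply: eq_bigr => p _; rewrite big_map.
Qed.

Lemma sqt_inv : exists Q : seq (H * H), forall W (B : H -> H -> W), bilin B ->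
  \tsum_(a, b <- R) \tsum_(c, d <- Q) B (a * c) (b * d) = B 1 1.
Proof.
case: sqtR => [[Q [RQ _]] _]; exists Q => W B Bb.
have := teq2_tsum RQ Bb; rewrite /tsum big_flatten_map big_seq1 => <-.
by apply: eq_bigr => p _; rewrite big_map.
Qed.

(** By (1) the element [e] is idempotent, and applying [eps] to the first legs of [R] and of its
    inverse gives [e] a right inverse; hence [e = 1]. *)
Lemma sqt_counitl : \tsum_(a, b <- R) eps a *: b = 1.
Proof.
have [Q RQ] := sqt_inv; set e := tsum _ _.
have ee : e * e = e.
  transitivity (\tsum_(a, b <- R) \tsum_(a', b' <- R) eps a *: (eps a' *: (b * b'))).
    rewrite /e (lin_tsum_pull _ _ (lin_mull _ (@lin_id _ H))); apply: eq_tsum => a b.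
    rewrite (lin_tsum_pull _ _ (lin_mulr _ (@lin_id _ H))); apply: eq_tsum => a' b'.
    by rewrite -scalerAl -scalerAr.
  rewrite -(sqt_coproductl (T := fun u v b => eps u *: (eps v *: b))); last by linearity.
  apply: eq_tsum => a b.
  by rewrite (comul_counitl (F := fun v => eps v *: b)) //; linearity.
have eQ : e * (\tsum_(c, d <- Q) eps c *: d) = 1.
  transitivity (eps 1 *: (1 : H)); last by rewrite (eps_1 hopf) scale1r.
  rewrite -(RQ _ (fun x y => eps x *: y)); last by linearity.
  rewrite /e (lin_tsum_pull _ _ (lin_mull _ (@lin_id _ H))); apply: eq_tsum => a b.
  rewrite (lin_tsum_pull _ _ (lin_mulr _ (@lin_id _ H))); apply: eq_tsum => a' b'.
  by rewrite -scalerAl -scalerAr scalerA (eps_mul hopf).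
by rewrite -[LHS]mulr1 -eQ mulrA ee.
Qed.

Lemma sqt_counitr : \tsum_(a, b <- R) eps b *: a = 1.
Proof.
have [Q RQ] := sqt_inv; set e := tsum _ _.
have ee : e * e = e.
  transitivity (\tsum_(a, b <- R) \tsum_(a', b' <- R) eps b' *: (eps b *: (a * a'))).
    rewrite /e (lin_tsum_pull _ _ (lin_mull _ (@lin_id _ H))); apply: eq_tsum => a b.
    rewrite (lin_tsum_pull _ _ (lin_mulr _ (@lin_id _ H))); apply: eq_tsum => a' b'.
    by rewrite -scalerAl -scalerAr !scalerA mulrC.
  rewrite -(sqt_coproductr (T := fun a u v => eps u *: (eps v *: a))); last by linearity.
  apply: eq_tsum => a b.
  by rewrite (comul_counitl (F := fun v => eps v *: a)) //; linearity.
have eQ : e * (\tsum_(c, d <- Q) eps d *: c) = 1.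
  transitivity (eps 1 *: (1 : H)); last by rewrite (eps_1 hopf) scale1r.
  rewrite -(RQ _ (fun x y => eps y *: x)); last by linearity.
  rewrite /e (lin_tsum_pull _ _ (lin_mull _ (@lin_id _ H))); apply: eq_tsum => a b.
  rewrite (lin_tsum_pull _ _ (lin_mulr _ (@lin_id _ H))); apply: eq_tsum => a' b'.
  by rewrite -scalerAl -scalerAr scalerA (eps_mul hopf).
by rewrite -[LHS]mulr1 -eQ mulrA ee.
Qed.

(** [(S (x) id) R] is a right inverse of [R]: by (1) the product of second legs comes from a
    coproduct in the first leg, where the antipode axiom and [sqt_counitl] finish. *)
Lemma sqt_cancelr W (B : H -> H -> W) : bilin B ->
  \tsum_(a, b <- R) \tsum_(a', b' <- R) B (a * S a') (b * b') = B 1 1.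
Proof.
move=> Bb; rewrite -(sqt_coproductl (T := fun u v b => B (u * S v) b)); last by linearity.
rewrite -[X in _ = B _ X]sqt_counitl (lin_tsum_pull _ _ (Bb.2 1)); apply: eq_tsum => a b.
rewrite (comul_antipoder (F := fun z => B z b)) ?(linZ _ _ (Bb.2 1)) //.
by linearity.
Qed.

Lemma sqt_cancell W (B : H -> H -> W) : bilin B ->
  \tsum_(a, b <- R) \tsum_(a', b' <- R) B (S a * a') (b * b') = B 1 1.
Proof.
move=> Bb; rewrite -(sqt_coproductl (T := fun u v b => B (S u * v) b)); last by linearity.
rewrite -[X in _ = B _ X]sqt_counitl (lin_tsum_pull _ _ (Bb.2 1)); apply: eq_tsum => a b.
rewrite (comul_antipodel (F := fun z => B z b)) ?(linZ _ _ (Bb.2 1)) //.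
by linearity.
Qed.

(** Counterpart for (2). As (2) reverses the second legs, [(id (x) S) R] inverts [R] in
    [H (x) H^op], which explains the order [S b' * b]. *)
Lemma sqt_cancel_snd W (B : H -> H -> W) : bilin B ->
  \tsum_(a, b <- R) \tsum_(a', b' <- R) B (a * a') (S b' * b) = B 1 1.
Proof.
move=> Bb; rewrite -(sqt_coproductr (T := fun a u v => B a (S u * v))); last by linearity.
rewrite -[X in _ = B X _]sqt_counitr (lin_tsum_pull _ _ (Bb.1 1)); apply: eq_tsum => a b.
rewrite (comul_antipodel (F := fun z => B a z)) ?(linZ _ _ (Bb.1 1)) //.
by linearity.
Qed.

(** * The map [nu]: multiplicativity and compatibility with the antipode *)

Notation nu := (nuR Delta S R).

(** Both copies of [R] are brought outside the coproducts, so that in a product of two values of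
    [nu] neighbouring copies can be made to cancel. *)
Lemma nuE W (B : H -> H -> W) h :
  tsum (nu h) B = \tsum_(a, b <- R) \tsum_(a', b' <- R)
    \tsum_(x, y <- Delta h) \tsum_(u, v <- Delta y) B (b * u * b') (S x * S a * v * a').
Proof.
rewrite /tsum big_flatten_map; apply: eq_bigr => p _.
rewrite big_flatten_map; under eq_bigr do rewrite big_map /=.
rewrite exchange_big /=; apply: eq_bigr => p' _.
by rewrite big_flatten_map /=; apply: eq_bigr => q _; rewrite big_map.
Qed.

Lemma linT_nu : linT nu.
Proof.
move=> W B Bb a x y; rewrite !nuE; move: a x y; change (lin (fun h =>
 \tsum_(a, b <- R) \tsum_(a', b' <- R)
    \tsum_(x, y <- Delta h) \tsum_(u, v <- Delta y) B (b * u * b') (S x * S a * v * a'))).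
by linearity.
Qed.

Let nL := linT_nu.

Lemma nu_central h : in_tens_center (nu h).
Proof. by case: sqtR => _ [_ [_ [_ [_ []]]]]. Qed.

Lemma nu1 W (B : H -> H -> W) : bilin B -> tsum (nu 1) B = B 1 1.
Proof.
move=> Bb; rewrite nuE -[RHS](sqt_cancell (B := fun u v => B v u)); last by linearity.
apply: eq_tsum => a b; apply: eq_tsum => a' b'.
rewrite comul_1 ?comul_1; try by linearity.
by rewrite antipode1 !mulr1 mul1r.
Qed.

(** Since [z] is central, it can be inserted just after [S p] in the second leg of [nu h]. The last
    copy of [R] in [nu g] then meets the first one in [nu h] as [a1' * S a (x) b1' * b], which is
    trivial by [sqt_cancelr]; what remains is [nu (g * h)]. *)
Lemma nu_mul W (B : H -> H -> W) g h : bilin B ->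
  \tsum_(x, z <- nu g) \tsum_(y, w <- nu h) B (x * y) (z * w) = tsum (nu (g * h)) B.
Proof.
move=> Bb.
transitivity (\tsum_(x, z <- nu g) \tsum_(a, b <- R) \tsum_(a', b' <- R)
    \tsum_(p, y <- Delta h) \tsum_(u, v <- Delta y)
    B (x * (b * u * b')) (S p * z * S a * v * a')).
  apply: in_tens_center_eq; [exact: nu_central|by linearity|by linearity|].
  move=> x z zC; rewrite nuE; do 4!apply: eq_tsum => ? ?.
  by rewrite !mulrA (zC (S _)).
rewrite !nuE.
transitivity (\tsum_(a1, b1 <- R) \tsum_(a1', b1' <- R) \tsum_(a, b <- R)
  \tsum_(a', b' <- R)
    \tsum_(p1, y1 <- Delta g) \tsum_(p, y <- Delta h) \tsum_(u1, v1 <- Delta y1)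
      \tsum_(u, v <- Delta y)
    B (b1 * u1 * (b1' * b) * u * b') (S p * S p1 * S a1 * v1 * (a1' * S a) * v * a')).
  by reorder; rewrite !mulrA.
apply: eq_tsum => a1 b1.
transitivity (\tsum_(a', b' <- R) \tsum_(a1', b1' <- R) \tsum_(a, b <- R)
    \tsum_(p1, y1 <- Delta g) \tsum_(p, y <- Delta h) \tsum_(u1, v1 <- Delta y1)
      \tsum_(u, v <- Delta y)
    B (b1 * u1 * (b1' * b) * u * b') (S p * S p1 * S a1 * v1 * (a1' * S a) * v * a')).
  rewrite [RHS]exchange_tsum; apply: eq_tsum => a1' b1'; exact: exchange_tsum.
apply: eq_tsum => a' b'.
rewrite (sqt_cancelr (B := fun A B' => \tsum_(p1, y1 <- Delta g) \tsum_(p, y <- Delta h)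
    \tsum_(u1, v1 <- Delta y1) \tsum_(u, v <- Delta y)
    B (b1 * u1 * B' * u * b') (S p * S p1 * S a1 * v1 * A * v * a'))); last by linearity.
rewrite comul_mul; last by linearity.
apply: eq_tsum => p1 y1; apply: eq_tsum => p y.
rewrite comul_mul; last by linearity.
apply: eq_tsum => u1 v1; apply: eq_tsum => u v.
by rewrite antipodeM !mulr1 !mulrA.
Qed.

(** Centrality of [w] lets it move to the left of the last factor [a'] of [z]. Four contractions
    follow: [v * S x'] by the antipode, [c * a (x) S b * d] by [sqt_cancel_snd], then [S u * u'] and
    [S x * v'] by the antipode. The last pair of copies of [R] cancels by [sqt_cancel_snd] again. *)
Lemma nu_antipode_convl W (B : H -> H -> W) h : bilin B ->
  \tsum_(p, q <- Delta h) \tsum_(x, z <- nu p) \tsum_(y, w <- nu q) B (S x * y) (z * w) =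
  eps h *: B 1 1.
Proof.
move=> Bb.
(* The full summand after [w] has been moved: [h] is split, in this order, into
   [x, u, v, x', u', v']. The letters [a, b, a', b'] come from [nu p] and [c, d, c', d'] from
   [nu q]. *)
pose K (c d c' d' a b a' b' x u v x' u' v' : H) :=
  B (S b' * S u * (S b * d) * u' * d') (S x * S a * (v * S x') * S c * v' * c' * a').
transitivity (\tsum_(p, q <- Delta h) \tsum_(y, w <- nu q) \tsum_(a, b <- R)
  \tsum_(a', b' <- R)
    \tsum_(x, s <- Delta p) \tsum_(u, v <- Delta s)
    B (S (b * u * b') * y) (S x * S a * v * w * a')).
  apply: eq_tsum => p q; rewrite exchange_tsum.
  apply: in_tens_center_eq; [exact: nu_central|by linearity|by linearity|].
  move=> y w wC; rewrite nuE; do 4!apply: eq_tsum => ? ?.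
  by rewrite -!mulrA -(wC _).
transitivity (\tsum_(c, d <- R) \tsum_(a, b <- R) \tsum_(c', d' <- R) \tsum_(a', b' <- R)
  \tsum_(p, q <- Delta h) \tsum_(x, s <- Delta p) \tsum_(u, v <- Delta s)
  \tsum_(x', s' <- Delta q)
    \tsum_(u', v' <- Delta s') K c d c' d' a b a' b' x u v x' u' v').
  transitivity (\tsum_(c, d <- R) \tsum_(c', d' <- R) \tsum_(a, b <- R) \tsum_(a', b' <- R)
    \tsum_(p, q <- Delta h) \tsum_(x, s <- Delta p) \tsum_(u, v <- Delta s)
    \tsum_(x', s' <- Delta q)
      \tsum_(u', v' <- Delta s') K c d c' d' a b a' b' x u v x' u' v').
    under eq_tsum do rewrite nuE.
    by reorder; rewrite /K !antipodeM !mulrA.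
  by apply: eq_tsum => c d; rewrite exchange_tsum.
transitivity (\tsum_(c, d <- R) \tsum_(a, b <- R) \tsum_(c', d' <- R) \tsum_(a', b' <- R)
  \tsum_(x, s <- Delta h) \tsum_(u, t <- Delta s) \tsum_(u', v' <- Delta t)
  B (S b' * S u * (S b * d) * u' * d') (S x * S (c * a) * v' * c' * a')).
  apply: eq_tsum => c d; apply: eq_tsum => a b; apply: eq_tsum => c' d'; apply: eq_tsum =>
    a' b'.
  rewrite comulA; last by rewrite /K; linearity.
  apply: eq_tsum => x s; rewrite comulA; last by rewrite /K; linearity.
  apply: eq_tsum => u t.
  rewrite -(comulA (T := fun v x' s' =>
    \tsum_(u', v' <- Delta s') K c d c' d' a b a' b' x u v x' u' v'));
    last by rewrite /K; linearity.
  apply: (comul_counitl (F := fun s' => \tsum_(u', v' <- Delta s')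
    B (S b' * S u * (S b * d) * u' * d') (S x * S (c * a) * v' * c' * a'))) => [z s'|]; last by linearity.
  rewrite exchange_tsum (lin_tsum_pull _ _ (lin_scaler _ (@lin_id _ _))); apply: eq_tsum =>
    u' v'.
  rewrite /K (comul_antipoder (F := fun z => B (S b' * S u * (S b * d) * u' * d')
    (S x * S a * z * S c * v' * c' * a'))) //; last by linearity.
  by rewrite antipodeM !mulr1 !mulrA.
rewrite (sqt_cancel_snd (B := fun A B' => \tsum_(c', d' <- R) \tsum_(a', b' <- R)
  \tsum_(x, s <- Delta h) \tsum_(u, t <- Delta s) \tsum_(u', v' <- Delta t)
  B (S b' * S u * B' * u' * d') (S x * S A * v' * c' * a'))); last by linearity.
transitivity (\tsum_(c', d' <- R) \tsum_(a', b' <- R) eps h *: B (S b' * d') (c' * a'));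
  last first.
  by rewrite (sqt_cancel_snd (B := fun x y => eps h *: B y x)) //; linearity.
apply: eq_tsum => c' d'; apply: eq_tsum => a' b'.
transitivity (\tsum_(x, v <- Delta h) B (S b' * d') (S x * v * (c' * a'))); last first.
  rewrite (comul_antipodel (F := fun z => B (S b' * d') (z * (c' * a')))) ?mul1r //.
  by linearity.
apply: eq_tsum => x s.
rewrite -(comulA (T := fun u u' v' => B (S b' * S u * 1 * u' * d')
  (S x * S 1 * v' * c' * a'))); last by linearity.
apply: (comul_counitl (F := fun v => B (S b' * d') (S x * v * (c' * a')))) => [r v|];
  last by linearity.
rewrite (comul_antipodel (F := fun z => B (S b' * z * d')
  (S x * v * (c' * a')))) ?mulr1 //; last by linearity.
by move=> *; rewrite antipode1 !mulr1 !mulrA.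
Qed.

(* [h |-> S (h_0) (x) h_1] and [nu \o S] are both convolution inverses of [nu]. *)
Lemma nu_antipode W (B : H -> H -> W) h : bilin B ->
  tsum (nu (S h)) B = \tsum_(x, z <- nu h) B (S x) z.
Proof.
move=> Bb.
pose T p q r := \tsum_(x, z <- nu p) \tsum_(y, w <- nu q) \tsum_(t, c <- nu (S r))
  B (S x * y * t) (z * w * c).
have Tt : trilin T by rewrite /T; linearity.
transitivity (\tsum_(q, r <- Delta h) \tsum_(p, q <- Delta q) T p q r).
  symmetry; apply: (comul_counitl (F := fun r => tsum (nu (S r)) B)) => [s r|];
    last by linearity.
  rewrite /T (nu_antipode_convl (B := fun x z => \tsum_(t, c <- nu (S r))
    B (x * t) (z * c))); last by linearity.
  by congr (_ *: _); apply: eq_tsum => t c; rewrite !mul1r.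
rewrite comulA //.
apply: (comul_counitr (F := fun p => \tsum_(x, z <- nu p) B (S x) z)) => [p s|];
  last by linearity.
rewrite /T; transitivity (\tsum_(x, z <- nu p) \tsum_(q, r <- Delta s)
    \tsum_(y, w <- nu q) \tsum_(t, c <- nu (S r)) B (S x * (y * t)) (z * (w * c))).
  by reorder; rewrite !mulrA.
rewrite (lin_tsum_pull _ _ (lin_scaler _ (@lin_id _ _))); apply: eq_tsum => x z.
rewrite (comul_antipoder (F := fun r => \tsum_(t, c <- nu r) B (S x * t) (z * c))).
- by rewrite nu1 ?mulr1 //; linearity.
- by move=> q r; rewrite -nu_mul //; linearity.
- by linearity.
Qed.

(** Reads the right-hand side of condition (ii) as [nu h] acting on [s]. The carrier [V] is
    arbitrary because both [M] and its dual are instances. *)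
Lemma tsum_compat (V W : lmodType k) (actV : H -> V -> V) (s : seq (V * H))
    (B : V -> H -> W) h :
  tsum (flatten [seq flatten [seq flatten [seq
          [seq (actV (r.2 * t.1.2 * r'.2) p.1, S t.1.1 * S r.1 * t.2 * r'.1 * p.2)
          | p <- s] | r' <- R] | t <- Delta2 Delta h] | r <- R]) B =
  \tsum_(x, z <- nu h) \tsum_(v, c <- s) B (actV x v) (z * c).
Proof.
rewrite /tsum !big_flatten_map; apply: eq_bigr => r _.
rewrite !big_flatten_map; apply: eq_bigr => t _.
rewrite !big_map; apply: eq_bigr => q _.
by rewrite big_map big_flatten_map; apply: eq_bigr => r' _; rewrite big_map.
Qed.

(** * Normal modules and their duals *)

Section NormalModule.
Variables (M : vectType k) (act : H -> M -> M) (nuM : M -> seq (M * H)).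
Hypothesis normalM : normal_module Delta S eps R act nuM.

Lemma bilin_act : bilin act.
Proof. by case: normalM => [[aL [aR _]] _]; split=> [m a x y|x a m n];
  [apply: aL|apply: aR]. Qed.

Lemma linT_coact : linT nuM.
Proof. by case: normalM => [_ [[L _] _]]; apply: linT_cat. Qed.

Let aB := bilin_act.
Let ML := linT_coact.

Lemma coactA W (T : M -> H -> H -> W) m : trilin T ->
  \tsum_(m0, m1 <- nuM m) \tsum_(a, b <- Delta m1) T m0 a b =
  \tsum_(m0, m1 <- nuM m) \tsum_(n0, n1 <- nuM m0) T n0 n1 m1.
Proof.
case: normalM => [_ [[_ [E _]] _]] Tt; have := teq3_sum (E m) Tt.
rewrite !big_flatten_map /tsum; under eq_bigr do rewrite big_map /=.
by move=> ->; apply: eq_bigr => p _; rewrite big_map.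
Qed.

Lemma coact_counit W (F : M -> W) (G : M -> H -> W) m :
  (forall n c, G n c = eps c *: F n) -> lin F -> tsum (nuM m) G = F m.
Proof.
case: normalM => [_ [[_ [_ E]] _]] GF FL; rewrite -[in RHS](E m) (lin_sum _ _ FL).
by apply: eq_bigr => p _; rewrite GF (linZ _ _ FL).
Qed.

Lemma coact_central m : in_tens_center (nuM m).
Proof. by case: normalM => [_ [_ []]]. Qed.

Lemma coact_act W (B : M -> H -> W) h m : bilin B ->
  tsum (nuM (act h m)) B =
  \tsum_(x, z <- nu h) \tsum_(m0, m1 <- nuM m) B (act x m0) (z * m1).
Proof.
case: normalM => [_ [_ [_ E]]] Bb.
by rewrite (teq2_tsum (E h m) Bb) tsum_compat.
Qed.

(* [m |-> m_0 (x) S m_1] inverts the coaction, so [nu y] is [y] conjugated by it. *)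
Lemma nu_act W (K : M -> H -> W) y m : bilin K ->
  \tsum_(x, z <- nu y) K (act x m) z =
  \tsum_(m0, m1 <- nuM m) \tsum_(n0, n1 <- nuM (act y m0)) K n0 (n1 * S m1).
Proof.
move=> Kb; symmetry.
transitivity (\tsum_(m0, m1 <- nuM m) \tsum_(n0, n1 <- nuM m0)
    \tsum_(x, z <- nu y) K (act x n0) (z * n1 * S m1)).
  apply: eq_tsum => m0 m1; rewrite coact_act; last by linearity.
  exact: exchange_tsum.
rewrite -(coactA (T := fun n0 n1 m1 => \tsum_(x, z <- nu y) K (act x n0) (z * n1 * S m1)));
  last by linearity.
apply: (coact_counit (F := fun m => \tsum_(x, z <- nu y) K (act x m) z)) => [n c|];
  last by linearity.
rewrite (comul_antipoder (F := fun c => \tsum_(x, z <- nu y) K (act x n) (z * c))).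
- by under eq_tsum do rewrite mulr1.
- by move=> a b; apply: eq_tsum => x z; rewrite mulrA.
- by linearity.
Qed.

(* Both sides are inverses of the coaction: [m_2 S^-1(m_1) = eps] and [m_1] is central. *)
Lemma coact_antipode W (K : M -> H -> W) m : bilin K ->
  \tsum_(m0, m1 <- nuM m) K m0 (S m1) = \tsum_(m0, m1 <- nuM m) K m0 (Sinv m1).
Proof.
move=> Kb.
(* The middle term is [m_0 (x) m_2 S^-1(m_1) S(m_3)]. Its first two factors contract to give the
   left side; once the central [S^-1(m_1)] is moved to the end, [m_2 S(m_3)] contracts to give the
   right side. *)
transitivity (\tsum_(m0, m1 <- nuM m) \tsum_(n0, n1 <- nuM m0) \tsum_(b, c <- Delta m1)
    K n0 (b * Sinv n1 * S c)).
  rewrite -(coactA (T := fun n0 n1 m1 =>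
    \tsum_(b, c <- Delta m1) K n0 (b * Sinv n1 * S c))); last by linearity.
  apply: eq_tsum => n0 y.
  rewrite -(comulA (T := fun a b c => K n0 (b * Sinv a * S c))); last by linearity.
  symmetry; apply: (comul_counitl (F := fun c => K n0 (S c))) => [w c|]; last by linearity.
  by rewrite (comul_antipode_inv (F := fun z => K n0 (z * S c))) ?mul1r //; linearity.
apply: (coact_counit (F := fun m => \tsum_(n0, n1 <- nuM m) K n0 (Sinv n1))) => [n y|];
  last by linearity.
rewrite (lin_tsum_pull _ _ (lin_scaler _ (@lin_id _ _))).
apply: in_tens_center_eq; [exact: coact_central|by linearity|by linearity|].
move=> n0 a aC; rewrite (comul_antipoder (F := fun z => K n0 (z * Sinv a))) ?mul1r //;
  last by linearity.
by move=> b c; rewrite -!mulrA (central_antipode_inv aC).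
Qed.

(** This is condition (ii) for the dual, evaluated at [m]. By [nu_antipode] the left side involves
    [nu (S h)], which [nu_act] turns into a conjugate of [S h] by the coaction. Since [n1] is
    central, it can be placed next to [Sinv l1], and the two contract; the remaining [S m1] agrees
    with [Sinv m1] by [coact_antipode]. *)
Lemma coact_antipode_act W (F : M -> H -> W) h m : bilin F ->
  \tsum_(x, z <- nu h) \tsum_(m0, m1 <- nuM (act (S x) m)) F m0 (z * Sinv m1) =
  \tsum_(m0, m1 <- nuM m) F (act (S h) m0) (Sinv m1).
Proof.
move=> Fb.
rewrite -(nu_antipode (B := fun x z =>
  \tsum_(m0, m1 <- nuM (act x m)) F m0 (z * Sinv m1))); last by linearity.
rewrite (nu_act (K := fun n z => \tsum_(m0, m1 <- nuM n) F m0 (z * Sinv m1)));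
  last by linearity.
rewrite -(coact_antipode (K := fun m0 c => F (act (S h) m0) c)); last by linearity.
apply: eq_tsum => m0 m1.
transitivity (\tsum_(n0, n1 <- nuM (act (S h) m0))
  \tsum_(l0, l1 <- nuM n0) F l0 (S m1 * n1 * Sinv l1)).
  apply: in_tens_center_eq; [exact: coact_central|by linearity|by linearity|].
  by move=> n0 n1 n1C; rewrite n1C.
rewrite -(coactA (T := fun l0 l1 n1 => F l0 (S m1 * n1 * Sinv l1))); last by linearity.
apply: (coact_counit (F := fun n => F n (S m1))) => [n c|]; last by linearity.
rewrite (comul_antipode_inv (F := fun z => F n (S m1 * z))) ?mulr1 //; last by linearity.
by move=> a b; rewrite mulrA.
Qed.

(** * The dual of a finite dimensional normal module *)

Section Dual.
Variables (n : nat) (X : n.-tuple M).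
Hypothesis Xbasis : basis_of fullv X.

Local Notation dual := 'Hom(M, k^o).
Local Notation xs i := (linfun (coord X i : M -> k^o) : dual).
Local Notation dact := (dual_act S act).
Local Notation dcoact := (dual_coact Sinv nuM X).

(** [dual_act] applies [linfun] to a bare function, and [lfunE] needs a linear structure; it is
    packed here from the proof of [lin g]. *)
Lemma linfun_lin (g : M -> k^o) m : lin g -> linfun g m = g m.
Proof.
move=> gL.
pose g' : {linear M -> k^o} := HB.pack g (GRing.isLinear.Build _ _ _ _ g gL).
exact: (lfunE g').
Qed.

Lemma lin_coord i : lin (coord X i : M -> k^o).
Proof. by move=> a x y; rewrite linearP. Qed.

Lemma dual_actE h (f : dual) m : dact h f m = f (act (S h) m).
Proof. by rewrite linfun_lin //; linearity. Qed.

Lemma dual_expansion (f : dual) : f = \sum_(i < n) (f X`_i : k) *: xs i.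
Proof.
apply/lfunP => m; rewrite sum_lfunE {1}(coord_basis Xbasis (memvf m)) linear_sum.
apply: eq_bigr => i _; rewrite linearZ scale_lfunE linfun_lin; last exact: lin_coord.
by rewrite /GRing.scale /= mulrC.
Qed.

Lemma dual_lin_expansion W (F : dual -> W) f : lin F -> F f = \sum_(i < n) (f X`_i : k) *: F (xs i).
Proof.
move=> FL; rewrite {1}(dual_expansion f) (lin_sum _ _ FL).
by apply: eq_bigr => i _; rewrite (linZ _ _ FL).
Qed.

(** The basis-free form [f_0(m) f_1 = f(m_0) S^-1(m_1)] of the coaction, obtained by expanding [m]
    in the basis [X]. The comodule axioms and the compatibility condition are checked through it. *)
Lemma dual_coact_eval W (G : H -> W) f m : lin G ->
  \tsum_(g, c <- dcoact f) (g m : k) *: G c =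
  \tsum_(m0, m1 <- nuM m) (f m0 : k) *: G (Sinv m1).
Proof.
move=> GL; pose B n c := (f n : k) *: G (Sinv c).
have Bb : bilin B by rewrite /B; linearity.
rewrite [in RHS](coord_basis Xbasis (memvf m)) (lin_sum _ _ (ML Bb)).
rewrite {1}/tsum big_flatten_map big_enum /=; apply: eq_bigr => i _.
rewrite (linZ _ _ (ML Bb)) big_map scaler_sumr; apply: eq_bigr => p _.
rewrite scale_lfunE linfun_lin; last exact: lin_coord.
by rewrite scalerA /GRing.scale /= mulrC.
Qed.

Lemma dual_teq2 (s t : seq (dual * H)) :
  (forall m (G : H -> k^o), lin G ->
    \tsum_(g, c <- s) (g m : k) *: G c = \tsum_(g, c <- t) (g m : k) *: G c) ->
  teq2 s t.
Proof.
move=> st; apply: teq2_bilin => B Bb.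
have E (r : seq (dual * H)) : tsum r B = \sum_(i < n) \tsum_(g, c <- r) (g X`_i : k) *:
  B (xs i) c.
  rewrite /tsum exchange_big; apply: eq_bigr => p _.
  by rewrite -(dual_lin_expansion (F := B^~ p.2)) //; linearity.
by rewrite !E; apply: eq_bigr => i _; apply: st; linearity.
Qed.

Lemma dual_is_left_module : is_left_module dact.
Proof.
split; [|split; [|split]].
- move=> a x y f; apply/lfunP => m; rewrite add_lfunE scale_lfunE !dual_actE.
  have L : lin (fun x => f (act (S x) m)) by linearity.
  exact: L.
- by move=> a x f g; apply/lfunP => m;
  rewrite add_lfunE scale_lfunE !dual_actE add_lfunE scale_lfunE.
- move=> f; apply/lfunP => m; rewrite dual_actE antipode1.
  by case: normalM => [[_ [_ [-> _]]] _].
- move=> x y f; apply/lfunP => m; rewrite !dual_actE antipodeM.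
  by case: normalM => [[_ [_ [_ ->]]] _].
Qed.

Lemma dual_is_right_comodule : is_right_comodule Delta eps dcoact.
Proof.
split; [|split].
- move=> a f g; apply: dual_teq2 => m G GL.
  rewrite tsum_cat tsum_scale; last by linearity.
  rewrite !dual_coact_eval //.
  have L : lin (fun f : dual =>
    \tsum_(m0, m1 <- nuM m) (f m0 : k) *: G (Sinv m1)) by linearity.
  exact: L.
- move=> f; apply: teq3_trilin => T Tt.
  transitivity (\tsum_(f0, f1 <- dcoact f) \tsum_(a, b <- Delta f1) T f0 a b).
    by rewrite big_flatten_map; apply: eq_bigr => p _; rewrite big_map.
  transitivity (\tsum_(f0, f1 <- dcoact f) \tsum_(g0, g1 <- dcoact f0) T g0 g1 f1);
    last first.
    by rewrite big_flatten_map; apply: eq_bigr => p _; rewrite big_map.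
  (* Both sides are linear in the first leg, so it suffices to evaluate that leg at each basis
     vector. *)
  have ET (g : dual) a b : T g a b = \sum_(i < n) (g X`_i : k) *: T (xs i) a b.
    by rewrite -(dual_lin_expansion (F := fun g => T g a b)) //; linearity.
  transitivity (\sum_(i < n) \tsum_(f0, f1 <- dcoact f) (f0 X`_i : k) *:
    \tsum_(a, b <- Delta f1) T (xs i) a b).
    rewrite /tsum exchange_big; apply: eq_bigr => p _.
    by rewrite -(dual_lin_expansion (F := fun g => \tsum_(a, b <- Delta p.2) T g a b)) //;
      linearity.
  transitivity (\sum_(i < n) \tsum_(f0, f1 <- dcoact f)
    \tsum_(g0, g1 <- dcoact f0) (g0 X`_i : k) *: T (xs i) g1 f1); last first.
    rewrite /tsum exchange_big; apply: eq_bigr => p _.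
    rewrite exchange_big; apply: eq_bigr => q _.
    by rewrite ET.
  apply: eq_bigr => i _.
  rewrite (dual_coact_eval (G := fun c => \tsum_(a, b <- Delta c) T (xs i) a b));
    last by linearity.
  (* [Sinv] reverses the coproduct, and evaluating the two nested dual coactions also reverses the
     order of the legs; the two reversals match. *)
  transitivity (\tsum_(m0, m1 <- nuM X`_i)
    \tsum_(a, b <- Delta m1) (f m0 : k) *: T (xs i) (Sinv b) (Sinv a)).
    apply: eq_tsum => m0 m1; rewrite antipode_inv_comul; last by linearity.
    exact: (lin_tsum_pull _ _ (lin_scaler _ (@lin_id _ _))).
  rewrite (coactA (T := fun m0 a b => (f m0 : k) *: T (xs i) (Sinv b) (Sinv a)));
    last by linearity.
  transitivity (\tsum_(m0, m1 <- nuM X`_i)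
    \tsum_(f0, f1 <- dcoact f) (f0 m0 : k) *: T (xs i) (Sinv m1) f1).
    by apply: eq_tsum => m0 m1; rewrite dual_coact_eval; last by linearity.
  rewrite exchange_tsum; apply: eq_tsum => f0 f1.
  by rewrite (dual_coact_eval (G := fun c => T (xs i) c f1)) //; linearity.
- move=> f; apply/lfunP => m; rewrite sum_lfunE.
  transitivity (\tsum_(g, c <- dcoact f) (g m : k) *: (eps c : k^o)).
    by apply: eq_bigr => p _; rewrite scale_lfunE /GRing.scale /= mulrC.
  rewrite (dual_coact_eval (G := eps : H -> k^o)) //.
  apply: (coact_counit (F := f)) => [m0 m1|]; last exact: linearP.
  by rewrite counit_antipode_inv /GRing.scale /= mulrC.
Qed.

Lemma dual_coact_central f : in_tens_center (dcoact f).
Proof.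
have [t tP] := fin_all_exists (fun i : 'I_n => coact_central X`_i).
exists (flatten [seq [seq ((f p.1 : k) *: xs i, Sinv p.2) | p <- t i] | i <- enum 'I_n]).
split=> [|_ /flattenP [_ /mapP [i _ ->] /mapP [p pt ->]]]; last first.
  exact/central_antipode_inv/((tP i).2).
apply: teq2_bilin => B Bb; rewrite /tsum !big_flatten_map; apply: eq_bigr => i _.
rewrite !big_map /=.
apply: (teq2_tsum (tP i).1 (B := fun m c => B ((f m : k) *: xs i) (Sinv c))).
by linearity.
Qed.

Lemma dual_normal_module : normal_module Delta S eps R dact dcoact.
Proof.
split; first exact: dual_is_left_module.
split; first exact: dual_is_right_comodule.
split=> [f|h f]; first exact: dual_coact_central.
apply: dual_teq2 => m G GL; rewrite tsum_compat dual_coact_eval //.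
under eq_tsum do rewrite dual_actE.
rewrite -(coact_antipode_act (F := fun m c => (f m : k) *: G c)); last by linearity.
apply: eq_tsum => x z; under [RHS]eq_tsum do rewrite dual_actE.
by rewrite (dual_coact_eval (G := fun c => G (z * c))) //; linearity.
Qed.

End Dual.
End NormalModule.
End Semiquasitriangular.
End Hopf.

Theorem theorem2p8 (k : fieldType) (H : algType k)
  (Delta : H -> seq (H * H)) (eps : H -> k) (S Sinv : H -> H)
  (R : seq (H * H)) (M : vectType k)
  (act : H -> M -> M) (nuM : M -> seq (M * H))
  (n : nat) (X : n.-tuple M) :
  is_hopf Delta eps S ->
  cancel S Sinv -> cancel Sinv S ->
  semiquasitriangular Delta S R ->
  normal_module Delta S eps R act nuM ->
  basis_of fullv X ->
  normal_module Delta S eps R (dual_act S act) (dual_coact Sinv nuM X).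
Proof.
move=> hopf SK SinvK sqtR normalM Xbasis.
exact: (dual_normal_module hopf SK SinvK sqtR normalM Xbasis).
Qed.
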